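(* Let $\mathfrak{A}$ be a unital $C^*$-algebra, $a\in\mathfrak{A}$ a nonzero positive element, and $t,s\ge 0$ real numbers with $t+s>0$. Then $v_{(a,(t,s))}(\cdot)$ is a semi-norm on $\mathfrak{A}_a$, and for every $x\in\mathfrak{A}_a$, $$\max\{t,s\}\,\|x\|_a\le v_{(a,(t,s))}(x)\le (t+s)\,\|x\|_a.$$
   Context: $\mathcal{S}(\mathfrak{A})$ is the set of states of $\mathfrak{A}$ and $\mathcal{S}_a(\mathfrak{A})=\{f/f(a): f\in\mathcal{S}(\mathfrak{A}),\ f(a)\ne 0\}$. For $x\in\mathfrak{A}$, $\|x\|_a=\sup\{\sqrt{f(x^*ax)}: f\in\mathcal{S}_a(\mathfrak{A})\}\in[0,\infty]$. An element $x^{\sharp_a}\in\mathfrak{A}$ is an $a$-adjoint of $x$ if $ax^{\sharp_a}=x^*a$; $\mathfrak{A}_a$ is the set of all elements of $\mathfrak{A}$ admitting an $a$-adjoint (a subalgebra of $\mathfrak{A}$ on which $\|\cdot\|_a$ is a finite semi-norm). $a$-adjoints need not be unique; $x^{\sharp_a}$ denotes an $a$-adjoint of $x$, with $(\lambda x)^{\sharp_a}=\overline{\lambda}x^{\sharp_a}$ for $\lambda\in\mathbb{C}$; the quantities in the claim do not depend on the choice. For $x\in\mathfrak{A}_a$ put $\mathfrak{R}_{(t,s)}(x)=tx+sx^{\sharp_a}$ and $v_{(a,(t,s))}(x)=\sup_{\theta\in\mathbb{R}}\|\mathfrak{R}_{(t,s)}(e^{i\theta}x)\|_a$. *)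

(* Defs.v *)
From HB Require Import structures.
From mathcomp Require Import all_boot all_order all_algebra.
From mathcomp Require Import all_classical all_reals all_analysis.
From mathcomp Require Import complex.
Import Order.TTheory GRing.Theory Num.Theory.
Import numFieldNormedType.Exports.
Import ComplexField.Normc.

Set Implicit Arguments.
Unset Strict Implicit.
Unset Printing Implicit Defensive.

Local Open Scope classical_set_scope.
Local Open Scope ring_scope.

(* The norm is a field of the structure, with values in R, rather than the norm
   of a normedModType: the library has no structure joining rings and normed
   modules below the number domains, and its hierarchy does not allow adding one
   afterwards.  Completeness is therefore stated with Cauchy sequences.
   Algebras in the library are unital with 1 != 0; the zero algebra is thus
   excluded, which is harmless as soon as some element is nonzero. *)
HB.mixin Record isCStarAlgebra (R : realType) A of GRing.Algebra R[i] A := {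
  cnorm : A -> R ;
  cnorm_eq0 : forall x : A, cnorm x = 0 -> x = 0 ;
  cnormD : forall x y : A, cnorm (x + y) <= cnorm x + cnorm y ;
  cnormZ : forall (c : R[i]) (x : A), cnorm (c *: x) = normc c * cnorm x ;
  cnormM : forall x y : A, cnorm (x * y) <= cnorm x * cnorm y ;
  cnorm_complete : forall u : nat -> A,
    (forall e : R, 0 < e -> exists N : nat, forall m n : nat,
       (N <= m)%N -> (N <= n)%N -> cnorm (u m - u n) < e) ->
    exists l : A, cnorm (u n - l) @[n --> \oo] --> (0 : R) ;
  star : A -> A ;
  starD : forall x y : A, star (x + y) = star x + star y ;
  starZ : forall (c : R[i]) (x : A), star (c *: x) = conjc c *: star x ;
  starM : forall x y : A, star (x * y) = star y * star x ;
  starK : forall x : A, star (star x) = x ;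
  cstar_identity : forall x : A, cnorm (star x * x) = cnorm x ^+ 2
}.

#[short(type="cstarAlgType")]
HB.structure Definition CStarAlgebra (R : realType) :=
  {A of GRing.Algebra R[i] A & isCStarAlgebra R A}.

(* Supremum computed in [0, +oo], so that the supremum of the empty set is 0
   rather than -oo. *)
Definition sup_nneg (R : realType) (S : set (\bar R)) : \bar R :=
  ereal_sup (0%E |` S).

Section CStar.
Context {R : realType} {A : cstarAlgType R}.
Implicit Types (a x y : A) (t s : R).

Definition positive a : Prop := exists b : A, a = star b * b.

Definition states : set {scalar A} :=
  [set f : {scalar A} | (forall x, positive x -> 0 <= f x) /\ f 1 = 1].

Definition states_at a : set (A -> R[i]) :=
  [set g | exists f : {scalar A},
     [/\ states f, f a != 0 & g = (fun x => f x / f a)]].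

(* g (x^* a x) is a nonnegative element of R[i] when a is positive, so its
   real part is its value. *)
Definition anorm a x : \bar R :=
  sup_nneg [set (Num.sqrt (complex.Re (g (star x * a * x))))%:E
           | g in states_at a].

Definition is_adjoint a x y : Prop := a * y = star x * a.

Definition adjointable a : set A := [set x | exists y, is_adjoint a x y].

Definition adjoint_choice a (sharp : A -> A) : Prop :=
  (forall x, adjointable a x -> is_adjoint a x (sharp x)) /\
  (forall (c : R[i]) x, adjointable a x ->
     sharp (c *: x) = conjc c *: sharp x).

Definition Rmap t s (sharp : A -> A) x : A :=
  (t%:C)%C *: x + (s%:C)%C *: sharp x.

Definition cexpi (theta : R) : R[i] := (cos theta +i* sin theta)%C.

Definition vnorm a t s (sharp : A -> A) x : \bar R :=
  ereal_sup [set anorm a (Rmap t s sharp (cexpi theta *: x))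
            | theta in [set: R]].

(* The subspace requirement is part of the definition, since a semi-norm lives
   on a vector space. *)
Definition seminorm_on (D : set A) (p : A -> \bar R) : Prop :=
  [/\ D 0 /\ (forall (c : R[i]) x y, D x -> D y -> D (c *: x + y)),
      forall x, D x -> p x \is a fin_num /\ (0 <= p x)%E,
      forall (c : R[i]) x, D x ->
        p (c *: x) = ((normc c)%:E * p x)%E
    & forall x y, D x -> D y -> (p (x + y)%R <= p x + p y)%E].

End CStar.

(* Main.v *)
(* Write f_p(x, y) = f(x^* p y) for a positive functional f and positive p; this
   is a positive hermitian form, so Cauchy-Schwarz and Minkowski hold for it.
   The two points needing work are that the a-norm is finite on A_a and that
   passing to an a-adjoint preserves it.

   If a y = x^* a and w = y x, then a w^n is self-adjoint, and Cauchy-Schwarz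
   gives f(a w^n)^2 <= f(a) f(a w^(2n)).  Since f is bounded on self-adjoint
   elements, iterating and taking roots yields f(x^* a x) <= ||w|| f(a).

   Moreover f(y^* a y) = f(a x y), hence f(y^* a y)^2 <= f(a) f(y^* x^* a x y),
   and the last factor is at most ||x||_a^2 f(y^* a y).  So ||y||_a <= ||x||_a,
   with equality because x is in turn an a-adjoint of y.

   The upper bound is then the triangle inequality; the lower one averages
   R(x) with -i R(i x), resp. i R(i x), giving t x, resp. s x^#. *)

From HB Require Import structures.
Require Import Defs.
From mathcomp Require Import all_boot all_order all_algebra.
From mathcomp Require Import all_classical all_reals all_analysis.
From mathcomp Require Import complex.
From mathcomp Require Import ring lra.
Import Order.TTheory GRing.Theory Num.Theory.
Import numFieldNormedType.Exports.
Local Open Scope classical_set_scope.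
Local Open Scope ring_scope.

(** * Complex scalars: modulus, phases and polar form *)

Section Complex.
Set Implicit Arguments.
Unset Strict Implicit.
Context {R : realType}.
Implicit Types (c : R[i]) (r s theta phi : R).

Local Notation normc := ComplexField.Normc.normc.

Lemma ReD c d : complex.Re (c + d) = complex.Re c + complex.Re d.
Proof. by case: c; case: d. Qed.

Lemma normc_real r : normc (r%:C)%C = `|r|.
Proof. by rewrite /= expr0n addr0 sqrtr_sqr. Qed.

Lemma normc_conj c : normc (conjc c) = normc c.
Proof. by case: c => u v; rewrite /= sqrrN. Qed.

Lemma normc_ge0 c : 0 <= normc c.
Proof. by case: c => u v; exact: sqrtr_ge0. Qed.

Lemma conjc_mul_normc c : (conjc c * c)%C = ((normc c ^+ 2)%:C)%C.
Proof.
case: c => u v; rewrite /= sqr_sqrtr ?addr_ge0 ?sqr_ge0//.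
by apply/eqP; rewrite eq_complex /=; apply/andP; split; apply/eqP; ring.
Qed.

Lemma cexpiD theta phi : cexpi (theta + phi) = cexpi theta * cexpi phi.
Proof.
by apply/eqP; rewrite eq_complex /= cosD sinD eqxx /= addrC; apply/eqP; ring.
Qed.

Lemma cexpi0 : cexpi (0 : R) = 1.
Proof. by rewrite /cexpi cos0 sin0. Qed.

Lemma cexpi_pihalf : cexpi (pi / 2 : R) = 'i%C.
Proof. by rewrite /cexpi cos_pihalf sin_pihalf. Qed.

Lemma normc_cexpi theta : normc (cexpi theta) = 1.
Proof. by rewrite /= cos2Dsin2 sqrtr1. Qed.

Lemma normc_gt0 c : c != 0 -> 0 < normc c.
Proof.
move=> c0; rewrite lt_neqAle normc_ge0 andbT eq_sym.
by apply: contra_neq c0 => /ComplexField.Normc.eq0_normc.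
Qed.

(** Splits a scalar into modulus and phase; the phase will be absorbed into the angle of the
    supremum defining [vnorm]. *)
Lemma polar_form c : exists phi, c = (normc c)%:C%C * cexpi phi.
Proof.
have [->|c0] := eqVneq c 0.
  by exists 0; rewrite ComplexField.Normc.normc0 mul0r.
have := normc_gt0 c0; case: c c0 => u v _; set n := normc _ => n_gt0.
have n2 : n ^+ 2 = u ^+ 2 + v ^+ 2 by rewrite sqr_sqrtr ?addr_ge0 ?sqr_ge0.
have un : -1 <= u / n <= 1.
  rewrite ler_pdivrMr// ler_pdivlMr// mulN1r mul1r -ler_norml.
  by rewrite -(ler_sqr _ (ltW n_gt0)) ?nnegrE// real_normK ?num_real// n2 lerDl sqr_ge0.
have cosu : cos (acos (u / n)) = u / n by rewrite acosK// in_itv.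
have sinv : sin (acos (u / n)) = `|v| / n.
  rewrite sin_acos// -[RHS]ger0_norm ?divr_ge0 ?(ltW n_gt0)// -sqrtr_sqr.
  congr Num.sqrt; rewrite !expr_div_n real_normK ?num_real// n2.
  rewrite -n2; have : n ^+ 2 != 0 by rewrite expf_neq0 ?gt_eqF.
  by move=> n20; rewrite -(divff n20) -mulrBl n2 addrAC subrr add0r.
have n0 : n != 0 by rewrite gt_eqF.
(* [acos] only reaches the upper half circle, so the sign of [v] decides between the angle and its
   opposite. *)
have [v0|v0] := leP 0 v; [exists (acos (u / n)) | exists (- acos (u / n))];
  apply/eqP; rewrite eq_complex /= ?cosN ?sinN cosu sinv !mul0r subr0 addr0.
  by rewrite ger0_norm// ![n * _]mulrC !divfK// !eqxx.
by rewrite ltr0_norm// mulNr opprK ![n * _]mulrC !divfK// !eqxx.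
Qed.

End Complex.

(** * Norm and involution; positivity of [1 - h] for small self-adjoint [h] *)

Section CStarNorm.
Set Implicit Arguments.
Unset Strict Implicit.
Context {R : realType} {A : cstarAlgType R}.
Implicit Types (x y h : A) (c : R[i]) (r : R).

Local Notation normc := ComplexField.Normc.normc.
Local Notation half := ((2^-1 : R)%:C)%C.

Lemma starN x : star (- x) = - star x.
Proof.
rewrite -scaleN1r starZ -[in RHS]scaleN1r; congr (_ *: _).
by apply/eqP; rewrite eq_complex /= oppr0 eqxx /= oppr0.
Qed.

Lemma starB x y : star (x - y) = star x - star y.
Proof. by rewrite starD starN. Qed.

Lemma star0 : star (0 : A) = 0.
Proof. by have := starB 0 0; rewrite !subrr. Qed.

Lemma star1 : star (1 : A) = 1.
Proof. by rewrite -[LHS]mulr1 -[X in _ * X]starK -starM mulr1 starK. Qed.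

Lemma starZr r x : star ((r%:C)%C *: x) = (r%:C)%C *: star x.
Proof. by rewrite starZ /= oppr0. Qed.

Lemma cnorm0 : cnorm (0 : A) = 0.
Proof. by rewrite -(scale0r (0 : A)) cnormZ ComplexField.Normc.normc0 mul0r. Qed.

Lemma cnormN x : cnorm (- x) = cnorm x.
Proof.
by rewrite -scaleN1r cnormZ /= oppr0 expr0n addr0 sqrtr_sqr normrN1 mul1r.
Qed.

Lemma cnormBC x y : cnorm (x - y) = cnorm (y - x).
Proof. by rewrite -opprB cnormN. Qed.

Lemma cnorm_ge0 x : 0 <= cnorm x.
Proof. by have := cnormD x (- x); rewrite subrr cnorm0 cnormN; lra. Qed.

(** The C*-identity gives ||y||^2 <= ||y^*|| ||y||; cancel ||y||, then exchange y and y^*. *)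
Lemma cnorm_star x : cnorm (star x) = cnorm x.
Proof.
suff le_star y : cnorm y <= cnorm (star y).
  by apply/le_anti; rewrite le_star -{2}[x]starK le_star.
have := cnormM (star y) y; rewrite cstar_identity.
have [->|n0] := eqVneq (cnorm y) 0; first by rewrite cnorm_ge0.
by rewrite expr2 ler_pM2r // lt_neqAle eq_sym n0 cnorm_ge0.
Qed.

Lemma cnormMX x y n : cnorm (x * y ^+ n) <= cnorm x * cnorm y ^+ n.
Proof.
elim: n => [|n IH]; first by rewrite !expr0 !mulr1.
rewrite exprSr mulrA (le_trans (cnormM _ _))// exprSr mulrA.
by rewrite ler_wpM2r ?cnorm_ge0.
Qed.

Lemma cnorm_le_small x r : (forall e, 0 < e -> cnorm x <= r * e) -> x = 0.
Proof.
move=> small; apply: cnorm_eq0; apply/le_anti; rewrite cnorm_ge0 andbT.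
rewrite leNgt; apply/negP => x_gt0.
have r1 : 0 < `|r| + 1 by rewrite ltr_wpDl.
(* With this [e] the bound [r * e] is at most half of [cnorm x], whatever the sign of [r]. *)
have := small (cnorm x / (2 * (`|r| + 1))) _.
rewrite divr_gt0 ?mulr_gt0// => /(_ isT).
have : r * (cnorm x / (2 * (`|r| + 1))) <= cnorm x / 2.
  rewrite mulrA ler_pdivrMr ?mulr_gt0//.
  have := ler_norm r; nra.
lra.
Qed.

(* The iteration k := (h + k^2)/2 contracts the ball of radius 1/2; its fixed
   point satisfies (1 - k)^2 = 1 - h. *)
Fixpoint sqrt_iter h n : A :=
  if n is m.+1 then half *: (h + sqrt_iter h m * sqrt_iter h m) else 0.

Lemma half_normc : normc half = 2^-1.
Proof. by rewrite normc_real ger0_norm. Qed.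

Lemma star_sqrt_iter h n : star h = h -> star (sqrt_iter h n) = sqrt_iter h n.
Proof.
move=> hh; elim: n => [|n IH]; first by rewrite /= star0.
by rewrite /= starZr starD starM hh IH.
Qed.

(** Without commutativity, x^2 - y^2 = x (x - y) + (x - y) y; the iteration map thus has Lipschitz
    constant 1/2 on the ball of radius 1/2. *)
Lemma cnorm_half_sqrB h x y :
  cnorm (half *: (h + x * x) - half *: (h + y * y)) <=
  2^-1 * (cnorm x + cnorm y) * cnorm (x - y).
Proof.
rewrite -scalerBr cnormZ half_normc -mulrA ler_wpM2l//.
have -> : h + x * x - (h + y * y) = x * (x - y) + (x - y) * y.
  by rewrite mulrBr mulrBl addrA subrK opprD addrACA subrr add0r.
rewrite (le_trans (cnormD _ _))// [leRHS]mulrDl lerD ?cnormM//.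
by rewrite (le_trans (cnormM _ _))// mulrC.
Qed.

(** The ball is stable because (1/2 + 1/4) / 2 <= 1/2. *)
Lemma cnorm_sqrt_iter h n : cnorm h <= 2^-1 -> cnorm (sqrt_iter h n) <= 2^-1.
Proof.
move=> hh; elim: n => [|n IH]; first by rewrite /= cnorm0.
rewrite /= cnormZ half_normc.
have := cnormD h (sqrt_iter h n * sqrt_iter h n).
have := cnormM (sqrt_iter h n) (sqrt_iter h n).
have := cnorm_ge0 (sqrt_iter h n); nra.
Qed.

Lemma sqrt_iter_cauchy h n p : cnorm h <= 2^-1 ->
  cnorm (sqrt_iter h (n + p) - sqrt_iter h n) <= 2^-1 ^+ n.
Proof.
move=> hh; elim: n => [|n IH].
  rewrite /= add0n subr0 expr0 (le_trans (cnorm_sqrt_iter p hh))//; lra.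
rewrite addSn (le_trans (cnorm_half_sqrB _ _ _))// exprS.
have := cnorm_sqrt_iter n hh; have := cnorm_sqrt_iter (n + p) hh.
have := cnorm_ge0 (sqrt_iter h (n + p) - sqrt_iter h n); nra.
Qed.

Lemma sqrt_iter_cvg h : cnorm h <= 2^-1 ->
  exists l : A, forall e : R, 0 < e ->
    exists N, forall n, (N <= n)%N -> cnorm (sqrt_iter h n - l) < e.
Proof.
move=> hh; have [e e0|l /cvgr0Pnorm_lt ul] := cnorm_complete (sqrt_iter h).
  have /cvgr0Pnorm_lt /(_ _ e0) [N _ HN] : 2^-1 ^+ n @[n --> \oo] --> (0 : R).
    by apply: cvg_expr; rewrite ger0_norm// invf_lt1// ltr1n.
  have small k p : (N <= k)%N -> cnorm (sqrt_iter h (k + p) - sqrt_iter h k) < e.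
    move=> Nk; rewrite (le_lt_trans (sqrt_iter_cauchy _ _ hh))//.
    by rewrite (le_lt_trans (ler_norm _))// HN.
  exists N => m n Nm Nn; have [mn|/ltnW nm] := leqP m n.
    by rewrite cnormBC -(subnKC mn) small.
  by rewrite -(subnKC nm) small.
exists l => e e0; have [N _ HN] := ul _ e0.
by exists N => n Nn; rewrite (le_lt_trans (ler_norm _))// HN.
Qed.

(** The limit [l] of the iteration is self-adjoint and a fixed point, so 1 - h = (1 - l)^2 is of the
    form b^* b with b = 1 - l. *)
Lemma positive_1B h : star h = h -> cnorm h <= 2^-1 -> positive (1 - h).
Proof.
move=> hh h2; have [l ul] := sqrt_iter_cvg h2.
have sl : star l - l = 0.
  apply: (@cnorm_le_small _ 2) => e e0; have [N /(_ _ (leqnn N)) HN] := ul _ e0.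
  rewrite -(subrK (sqrt_iter h N) (star l)) -addrA (le_trans (cnormD _ _))//.
  rewrite -{1}(star_sqrt_iter N hh) -starB cnorm_star cnormBC.
  lra.
have fl : half *: (h + l * l) - l = 0.
  (* The constant is the Lipschitz factor for [l] and iterate [N], plus 1 for the distance from
     iterate [N.+1] to [l]. *)
  apply: (@cnorm_le_small _ (2^-1 * (cnorm l + 2^-1) + 1)) => e e0.
  have [N HN] := ul _ e0.
  rewrite -(subrK (sqrt_iter h N.+1) (half *: _)) -addrA.
  rewrite (le_trans (cnormD _ _))// mulrDl mul1r lerD ?(ltW (HN _ _))//.
  rewrite (le_trans (cnorm_half_sqrB _ _ _))// cnormBC.
  rewrite -!mulrA ler_wpM2l// ler_pM ?addr_ge0 ?cnorm_ge0//.
    by rewrite lerD2l cnorm_sqrt_iter.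
  exact/ltW/HN.
exists (1 - l); rewrite starB star1 (subr0_eq sl).
have : h + l * l = l + l.
  rewrite -{3 4}(subr0_eq fl) -scalerDl -rmorphD /=.
  by have -> : 2^-1 + 2^-1 = 1 :> R; [lra | rewrite scale1r].
move=> /(canRL (addrK _)) ->.
by rewrite mulrBr mulrBl mul1r mulr1 mulrBl mul1r !opprB !opprD !addrA addrAC.
Qed.

End CStarNorm.

(** A constant factor disappears under 2^k-th roots: if M < q, then (M / q)^n tends to 0 and falls
    below 1 / (|K| + 1). *)
Lemma le_of_exp_le {R : realType} (K M q : R) : 0 <= q -> 0 <= M ->
  (forall k, q ^+ (2 ^ k) <= K * M ^+ (2 ^ k)) -> q <= M.
Proof.
move=> q0 M0 qM; rewrite leNgt; apply/negP => Mq.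
have q_gt0 : 0 < q by apply: le_lt_trans Mq.
have K1 : 0 < `|K| + 1 by rewrite ltr_wpDl.
have rho0 : 0 <= M / q by rewrite divr_ge0.
have /cvgr0Pnorm_lt /(_ (`|K| + 1)^-1) : (M / q) ^+ n @[n --> \oo] --> (0 : R).
  by apply: cvg_expr; rewrite ger0_norm// ltr_pdivrMr// mul1r.
(* Since 2^N > N, the exponent 2^N lies in the tail where the bound holds. *)
rewrite invr_gt0 => /(_ K1) [N _ /(_ (2 ^ N)%N (ltnW (ltn_expl N (ltnSn 1))))].
rewrite ger0_norm ?exprn_ge0// expr_div_n ltr_pdivrMr ?exprn_gt0//.
rewrite mulrC ltr_pdivlMr// => Kq.
have := qM N; have := ler_norm K; have := exprn_ge0 (2 ^ N) M0.
nra.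
Qed.

(** * Positive functionals: Cauchy-Schwarz, boundedness and the estimate by [a]-adjoints *)

Section PositiveFunctional.
Set Implicit Arguments.
Unset Strict Implicit.
Context {R : realType} {A : cstarAlgType R}.
Implicit Types (a p u v x y z h : A) (k : R[i]) (f : {scalar A}).

Definition positive_functional f := forall x, positive x -> 0 <= f x.

Lemma star_positive p : positive p -> star p = p.
Proof. by move=> [b ->]; rewrite starM starK. Qed.

Lemma positive_star_mul x : positive (star x * x).
Proof. by exists x. Qed.

Lemma positive_conj p x : positive p -> positive (star x * p * x).
Proof. by move=> [b ->]; exists (b * x); rewrite starM !mulrA. Qed.

(** With y = 1 this rescales [f]; with k = 1 it carries estimates on positive functionals over to
    f(y^* . y). *)
Definition compress f y k z : R[i] := k * f (star y * z * y).

Lemma compress_scalar f y k : scalar (compress f y k).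
Proof.
move=> c u v; rewrite /compress mulrDr mulrDl -scalerAr -scalerAl linearP /=.
by rewrite mulrDr mulrCA.
Qed.

HB.instance Definition _ f y k :=
  GRing.isLinear.Build R[i] A R[i] *%R (compress f y k) (compress_scalar f y k).

Lemma positive_compress f y k : positive_functional f -> 0 <= k ->
  positive_functional (compress f y k).
Proof. by move=> pf k0 x px; rewrite mulr_ge0 ?pf//; exact: positive_conj. Qed.

Section Fixed.
Variables (f : {scalar A}) (pf : positive_functional f).

Local Notation F x := (complex.Re (f x)).

Lemma Re_functionalD x y : F (x + y) = F x + F y.
Proof. by rewrite linearD ReD. Qed.

Lemma Re_functionalZ (r : R) x : F ((r%:C)%C *: x) = r * F x.
Proof. by rewrite linearZ /=; case: (f x) => u v /=; rewrite mul0r subr0. Qed.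

Lemma Re_functional_ge0 x : positive x -> 0 <= F x.
Proof. by move=> /pf; rewrite lecE => /andP[]. Qed.

Lemma Im_functional x : positive x -> complex.Im (f x) = 0.
Proof. by move=> /pf; rewrite lecE => /andP[/eqP]. Qed.

Lemma functional_real x : positive x -> f x = (F x)%:C%C.
Proof. by move=> /Im_functional; case: (f x) => u v /= ->. Qed.

(* f is real on (1 + i x)^* (1 + i x), 1 and x^* x, hence on i (x - x^* ). *)
Lemma Re_functional_star x : F (star x) = F x.
Proof.
have := Im_functional (positive_star_mul (1 + 'i%C *: x)).
rewrite starD star1 starZ !(mulrDl, mulrDr) !(mul1r, mulr1) -scalerAl -scalerAr.
rewrite !linearD !linearZ /=.
have := Im_functional (positive_star_mul (1 : A)); rewrite star1 mulr1.
have := Im_functional (positive_star_mul x).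
case: (f 1) => ? ?; case: (f x) => ? ?; case: (f (star x)) => ? ?.
case: (f (star x * x)) => ? ? /=; lra.
Qed.

(** For real r, the value of [F] at (u + r v)^* (u + r v) is a nonnegative quadratic in r, whose two
    cross terms agree by [Re_functional_star]. *)
Lemma cauchy_schwarz u v :
  F (star u * v) ^+ 2 <= F (star u * u) * F (star v * v).
Proof.
have key (r : R) :
    0 <= F (star u * u) + 2 * r * F (star u * v) + r ^+ 2 * F (star v * v).
  have := Re_functional_star (star u * v); rewrite starM starK => Fvu.
  have pos := Re_functional_ge0 (positive_star_mul (u + (r%:C)%C *: v)).
  rewrite starD starZr mulrDl !mulrDr -!scalerAl -!scalerAr in pos.
  rewrite !Re_functionalD !Re_functionalZ Fvu in pos; lra.
have P0 := Re_functional_ge0 (positive_star_mul u).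
have Q0 := Re_functional_ge0 (positive_star_mul v).
move: P0 Q0 key; set P := F (star u * u); set Q := F (star v * v).
set B := F (star u * v) => P0 Q0 key.
have [Q00|Qn0] := eqVneq Q 0.
  have [->|Bn0] := eqVneq B 0; first by rewrite Q00 expr0n mulr0.
  (* For Q = 0 the polynomial is affine in r, and this r gives it the value -1. *)
  have := key (- (P + 1) / (2 * B)); rewrite Q00 mulr0 addr0.
  have -> : 2 * (- (P + 1) / (2 * B)) * B = - (P + 1) by field.
  lra.
have Qp : 0 < Q by rewrite lt_neqAle eq_sym Qn0.
(* The minimum is attained at -B / Q; multiplied by Q it equals P Q - B^2. *)
have := key (- B / Q); rewrite -(pmulr_lge0 _ Qp).
have -> : (P + 2 * (- B / Q) * B + (- B / Q) ^+ 2 * Q) * Q = P * Q - B ^+ 2.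
  by field.
by rewrite subr_ge0.
Qed.

Lemma cauchy_schwarz_weighted p u v : positive p ->
  F (star u * p * v) ^+ 2 <= F (star u * p * u) * F (star v * p * v).
Proof.
by move=> [b ->]; have := cauchy_schwarz (b * u) (b * v); rewrite !starM !mulrA.
Qed.

(** Both cross terms have the same real part, which Cauchy-Schwarz bounds by the product of the
    square roots. *)
Lemma minkowski_weighted p u v : positive p ->
  Num.sqrt (F (star (u + v) * p * (u + v))) <=
  Num.sqrt (F (star u * p * u)) + Num.sqrt (F (star v * p * v)).
Proof.
move=> pp; have CS := cauchy_schwarz_weighted u v pp.
have Bs : F (star v * p * u) = F (star u * p * v).
  by rewrite -Re_functional_star !starM starK (star_positive pp) mulrA.
have := Re_functional_ge0 (positive_conj u pp).
have := Re_functional_ge0 (positive_conj v pp).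
rewrite starD !mulrDl !mulrDr !Re_functionalD Bs.
move: CS; set P := F (star u * p * u); set Q := F (star v * p * v).
set B := F (star u * p * v) => CS Q0 P0.
rewrite -[leRHS]ger0_norm ?addr_ge0 ?sqrtr_ge0// -sqrtr_sqr ler_wsqrtr//.
rewrite sqrrD !sqr_sqrtr//.
have : B <= Num.sqrt P * Num.sqrt Q.
  by rewrite -sqrtrM// (le_trans (ler_norm _))// -sqrtr_sqr ler_wsqrtr.
lra.
Qed.

(** Cauchy-Schwarz for 1 and [a]. It ensures f(1) != 0 once f(a) = 1, so that f can be normalised to
    a state. *)
Lemma functional_eq0 a : positive a -> f 1 = 0 -> f a = 0.
Proof.
move=> pa f1; have := cauchy_schwarz 1 a.
rewrite star1 !mul1r f1 mul0r => Fa; rewrite functional_real//.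
suff -> : F a = 0 by [].
by apply/eqP; rewrite -sqrf_eq0 eq_le Fa sqr_ge0.
Qed.

(** Rescaling h to norm 1/2 makes 1 - h / (2 ||h||) positive. The factor 2 comes from that radius
    and vanishes later under roots. *)
Lemma functional_bound h : star h = h -> F h <= 2 * cnorm h * F 1.
Proof.
move=> hh; have [/cnorm_eq0 ->|n0] := eqVneq (cnorm h) 0.
  by rewrite linear0 cnorm0 mulr0 mul0r.
have np : 0 < cnorm h by rewrite lt_neqAle eq_sym n0 cnorm_ge0.
have n2 : 0 < 2 * cnorm h by rewrite mulr_gt0.
have /Re_functional_ge0 : positive (1 - ((2 * cnorm h)^-1%:C)%C *: h).
  apply: positive_1B; first by rewrite starZr hh.
  rewrite cnormZ normc_real ger0_norm ?invr_ge0 ?(ltW n2)//.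
  by rewrite invfM -mulrA mulVf// mulr1.
rewrite -scaleNr -rmorphN Re_functionalD Re_functionalZ mulNr subr_ge0.
by rewrite mulrC ler_pdivrMr// mulrC.
Qed.

(* With w = y x one has a w = x^* a x and w^* a = a w, so Cauchy-Schwarz gives
   f(a w^m)^2 <= f(a) f(a w^(2m)); iterate and take 2^k-th roots. *)
Lemma adjoint_bound a x y : positive a -> is_adjoint a x y -> f a = 1 ->
  F (star x * a * x) <= cnorm (y * x).
Proof.
move=> pa axy fa; pose w := y * x.
have aw : a * w = star x * a * x by rewrite mulrA axy.
have sw : star w * a = a * w.
  have := starM a w; rewrite (star_positive pa) => <-; rewrite aw.
  exact/star_positive/positive_conj.
have swn n : star (w ^+ n) * a = a * w ^+ n.
  elim: n => [|n IH]; first by rewrite !expr0 star1 mulr1 mul1r.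
  by rewrite exprSr starM -mulrA IH mulrA sw -mulrA -exprS exprSr.
have step n : F (a * w ^+ n) ^+ 2 <= F (a * w ^+ (n + n)).
  have := cauchy_schwarz_weighted 1 (w ^+ n) pa.
  by rewrite star1 !mul1r mulr1 fa mul1r swn -mulrA -exprD.
(* The constant comes from [functional_bound] at [a * w ^+ (2 ^ k)]; after roots only [cnorm w]
   survives. *)
rewrite -aw; apply: (@le_of_exp_le _ (2 * cnorm a * F 1)).
- by rewrite aw; exact/Re_functional_ge0/positive_conj.
- exact: cnorm_ge0.
move=> k; apply: (@le_trans _ _ (F (a * w ^+ (2 ^ k)))).
  elim: k => [|k IH]; first by rewrite expn0 !expr1.
  rewrite expnSr exprM muln2 -addnn (le_trans _ (step _))//.
  have F0 : 0 <= F (a * w) ^+ (2 ^ k).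
    by rewrite exprn_ge0// aw; exact/Re_functional_ge0/positive_conj.
  by rewrite ler_sqr ?nnegrE// (le_trans F0).
have saw : star (a * w ^+ (2 ^ k)) = a * w ^+ (2 ^ k).
  by rewrite starM (star_positive pa) swn.
rewrite (le_trans (functional_bound saw))// -!mulrA ler_wpM2l// mulrA mulrAC.
rewrite ler_wpM2r//.
  by have := Re_functional_ge0 (positive_star_mul (1 : A)); rewrite star1 mulr1.
exact: cnormMX.
Qed.

End Fixed.
End PositiveFunctional.

(** * The [a]-norm and its behaviour under [a]-adjoints *)

Section AWeightedNorm.
Set Implicit Arguments.
Unset Strict Implicit.
Context {R : realType} {A : cstarAlgType R}.
Implicit Types (p u v x y z h : A) (c k : R[i]) (f : {scalar A}) (m : \bar R).

Local Notation normc := ComplexField.Normc.normc.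

Variables (a : A) (pa : positive a).

Let rho f x : R := Num.sqrt (complex.Re (f (star x * a * x))).

(** Dividing by f(a), respectively by f(1), passes between the two normalisations; suprema then
    range over positive functionals with f(a) = 1. *)
Lemma states_atP (g : A -> R[i]) : states_at a g <->
  exists f, [/\ positive_functional f, f a = 1 & g = f].
Proof.
split=> [[f [[pf f1] fa0 ->]]|[f [pf fa ->]]].
  have fi : 0 <= (f a)^-1 by rewrite invr_ge0 pf.
  exists (compress f 1 (f a)^-1); split; first exact: positive_compress.
    by rewrite /= /compress star1 mulr1 mul1r mulVf.
  by apply/funext => x; rewrite /= /compress star1 mulr1 mul1r mulrC.
have f10 : f 1 != 0.
  by apply/eqP => /(functional_eq0 pf pa) fa0; move: (oner_eq0 R[i]); rewrite -fa fa0 eqxx.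
have fi : 0 <= (f 1)^-1.
  by rewrite invr_ge0 pf// -[1]mulr1 -{1}star1; exact: positive_star_mul.
exists (compress f 1 (f 1)^-1); split.
- split; first exact: positive_compress.
  by rewrite /= /compress star1 !mulr1 mulVf.
- by rewrite /= /compress star1 mulr1 mul1r fa mulr1 invr_eq0.
- apply/funext => x; rewrite /= /compress star1 !mulr1 !mul1r fa mulr1.
  by rewrite invrK mulrC mulrA mulfV// mul1r.
Qed.

(** The condition [0 <= m] reflects the 0 adjoined in [sup_nneg]. Later bounds are thereby checked
    one functional at a time. *)
Lemma anorm_leP x m : (anorm a x <= m)%E <->
  (0 <= m)%E /\ forall f, positive_functional f -> f a = 1 -> ((rho f x)%:E <= m)%E.
Proof.
split=> [/ereal_supP le_m|[m0 le_m]].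
  split=> [|f pf fa]; first by apply: le_m; left.
  by apply: le_m; right; exists (f : A -> R[i]) => //; apply/states_atP; exists f.
apply/ereal_supP => _ [->//|[g /states_atP[f [pf fa ->]] <-]].
exact: le_m.
Qed.

Lemma anorm_ge0 x : (0 <= anorm a x)%E.
Proof. by case: ((anorm_leP x (anorm a x)).1 (lexx _)). Qed.

Lemma rho_le_anorm x f : positive_functional f -> f a = 1 ->
  ((rho f x)%:E <= anorm a x)%E.
Proof. exact: ((anorm_leP x (anorm a x)).1 (lexx _)).2. Qed.

Lemma anormD x y : (anorm a (x + y)%R <= anorm a x + anorm a y)%E.
Proof.
apply/anorm_leP; split=> [|f pf fa]; first by rewrite adde_ge0 ?anorm_ge0.
rewrite (le_trans _ (leeD (rho_le_anorm x pf fa) (rho_le_anorm y pf fa)))//.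
by rewrite -EFinD lee_fin minkowski_weighted.
Qed.

Lemma anormZ_le c x : (anorm a (c *: x) <= (normc c)%:E * anorm a x)%E.
Proof.
apply/anorm_leP; split=> [|f pf fa].
  by rewrite mule_ge0 ?anorm_ge0// lee_fin normc_ge0.
rewrite (le_trans _ (lee_wpmul2l _ (rho_le_anorm x pf fa))) ?lee_fin ?normc_ge0//.
rewrite /rho starZ -!scalerAl -scalerAr scalerA conjc_mul_normc Re_functionalZ.
by rewrite sqrtrM ?sqr_ge0// sqrtr_sqr ger0_norm ?normc_ge0.
Qed.

(** As a is self-adjoint, x^* a is the adjoint of a x, so x^* a x depends on a x alone. This makes
    the choice of [a]-adjoint immaterial. *)
Lemma eq_anorm x y : a * x = a * y -> anorm a x = anorm a y.
Proof.
move=> axy; suff xy : star x * a * x = star y * a * y by rewrite /anorm xy.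
have : star x * a = star y * a by rewrite -{1 2}(star_positive pa) -!starM axy.
by move=> ->; rewrite -!mulrA axy.
Qed.

Lemma anorm_fin_num x : adjointable a x -> anorm a x \is a fin_num.
Proof.
move=> [y axy]; rewrite ge0_fin_numE ?anorm_ge0//.
apply: (@le_lt_trans _ _ (Num.sqrt (cnorm (y * x)))%:E); last exact: ltry.
apply/anorm_leP; split=> [|f pf fa]; first by rewrite lee_fin sqrtr_ge0.
by rewrite lee_fin ler_wsqrtr// adjoint_bound.
Qed.

(** Removes the normalisation f(a) = 1, so that the bound applies to compressed functionals. *)
Lemma anorm_dominates f x (M : R) : positive_functional f -> adjointable a x ->
  (anorm a x <= M%:E)%E ->
  complex.Re (f (star x * a * x)) <= M ^+ 2 * complex.Re (f a).
Proof.
move=> pf [y axy] xM; have [fa0|fa0] := eqVneq (f a) 0.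
  (* Division by f(a) is impossible here; as a y x = x^* a x, Cauchy-Schwarz against 1 forces the
     left side to vanish. *)
  have := cauchy_schwarz_weighted pf 1 (y * x) pa.
  rewrite star1 !mul1r mulr1 mulrA axy fa0 mul0r mulr0.
  by rewrite exprn_even_le0//= => /eqP ->.
have fi : 0 <= (f a)^-1 by rewrite invr_ge0 pf.
have := (anorm_leP x _).1 xM.
move=> [M0 /(_ _ (positive_compress 1 pf fi))]; rewrite /rho /= /compress star1.
rewrite !mulr1 !mul1r mulVf// => /(_ erefl).
rewrite (functional_real pf pa) (functional_real pf (positive_conj x pa)).
rewrite -fmorphV -rmorphM /= lee_fin => le_M; rewrite lee_fin in M0.
have Fa : 0 < complex.Re (f a).
  rewrite lt_neqAle Re_functional_ge0// andbT eq_sym.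
  by apply: contra_neq fa0 => Fa; rewrite (functional_real pf pa) Fa.
rewrite -ler_pdivrMr// mulrC -(sqr_sqrtr (_ : 0 <= _ * _)); last first.
  by rewrite mulr_ge0 ?invr_ge0 ?(ltW Fa)//; exact/Re_functional_ge0/positive_conj.
by rewrite ler_sqr ?nnegrE ?sqrtr_ge0.
Qed.

(* Since y^* a y = a x y, Cauchy-Schwarz bounds f(y^* a y)^2 by
   f(a) f(y^* (x^* a x) y), and f(y^* . y) is again a positive functional. *)
Lemma anorm_adjoint_le x y : is_adjoint a x y -> (anorm a y <= anorm a x)%E.
Proof.
move=> axy; have adx : adjointable a x by exists y.
have xM := fineK (anorm_fin_num adx).
have M0 : 0 <= fine (anorm a x) by rewrite fine_ge0 ?anorm_ge0.
move: M0 xM; set M := fine _ => M0 xM; rewrite -xM.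
apply/anorm_leP; split=> [|f pf fa]; rewrite lee_fin//.
have sya : star y * a = a * x.
  by rewrite -{1}(star_positive pa) -starM axy starM starK star_positive.
have := cauchy_schwarz_weighted pf 1 (x * y) pa.
rewrite star1 !mul1r mulr1 fa mul1r.
have := anorm_dominates (positive_compress y pf ler01) adx (M := M).
rewrite -xM lexx => /(_ isT); rewrite /= /compress !mul1r.
rewrite starM !mulrA -sya => dom cs.
have P0 := Re_functional_ge0 pf (positive_conj y pa).
rewrite /rho -[leRHS](ger0_norm M0) -sqrtr_sqr ler_wsqrtr//.
move: P0 dom cs; set P := complex.Re (f (star y * a * y)).
(* From P^2 <= M^2 P, cancel P unless it is 0. *)
move=> P0 dom /le_trans /(_ dom); have [->|Pn0] := eqVneq P 0; first by rewrite sqr_ge0.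
by rewrite expr2 ler_pM2r// lt_neqAle eq_sym Pn0.
Qed.

End AWeightedNorm.

(** * The semi-norm [vnorm] and its comparison with the [a]-norm *)

Section VNorm.
Set Implicit Arguments.
Unset Strict Implicit.
Context {R : realType} {A : cstarAlgType R}.
Implicit Types (x y z : A) (c k : R[i]) (theta : R).

Local Notation normc := ComplexField.Normc.normc.

Variables (a : A) (t s : R) (sharp : A -> A).
Hypotheses (pa : positive a) (t0 : 0 <= t) (s0 : 0 <= s).
Hypothesis sharpP : adjoint_choice a sharp.

(** A real-valued [a]-norm, faithful on adjointable elements by finiteness; [fine] sends an infinite
    value to 0. *)
Let N x : R := fine (anorm a x).
Let Rx x k : A := Rmap t s sharp (k *: x).

Lemma is_adjoint_linear c x y x' y' : is_adjoint a x x' -> is_adjoint a y y' ->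
  is_adjoint a (c *: x + y) (conjc c *: x' + y').
Proof.
move=> xx' yy'; rewrite /is_adjoint starD starZ mulrDr mulrDl -scalerAr -scalerAl.
by rewrite xx' yy'.
Qed.

Lemma adjointable0 : adjointable a 0.
Proof. by exists 0; rewrite /is_adjoint star0 mulr0 mul0r. Qed.

Lemma adjointable_linear c x y : adjointable a x -> adjointable a y ->
  adjointable a (c *: x + y).
Proof.
by move=> [x' xx'] [y' yy']; exists (conjc c *: x' + y'); exact: is_adjoint_linear.
Qed.

Lemma adjointableZ c x : adjointable a x -> adjointable a (c *: x).
Proof. by move=> ax; rewrite -[_ *: x]addr0; exact: adjointable_linear adjointable0. Qed.

Lemma is_adjoint_sharp x : adjointable a x -> is_adjoint a x (sharp x).
Proof. exact: sharpP.1. Qed.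

Lemma is_adjoint_sym x y : is_adjoint a x y -> is_adjoint a y x.
Proof.
move=> axy; rewrite /is_adjoint -{2}(star_positive pa) -starM axy starM starK.
by rewrite star_positive.
Qed.

Lemma adjointable_sharp x : adjointable a x -> adjointable a (sharp x).
Proof. by move=> /is_adjoint_sharp /is_adjoint_sym ?; exists x. Qed.

Lemma anormE x : adjointable a x -> anorm a x = (N x)%:E.
Proof. by move=> ax; rewrite fineK// anorm_fin_num. Qed.

Lemma N_ge0 x : 0 <= N x.
Proof. by rewrite fine_ge0// anorm_ge0. Qed.

Lemma ND c x y k : adjointable a x -> adjointable a y ->
  N (c *: x + k *: y) <= normc c * N x + normc k * N y.
Proof.
move=> ax ay; rewrite -lee_fin -anormE; last exact/adjointable_linear/adjointableZ.
rewrite (le_trans (anormD _ _ _))// EFinD !EFinM -!anormE//.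
by rewrite leeD ?anormZ_le.
Qed.

(** The reverse inequality is the direct one for c^-1 and c x. *)
Lemma NZ c x : adjointable a x -> N (c *: x) = normc c * N x.
Proof.
have NZ_le k z : adjointable a z -> N (k *: z) <= normc k * N z.
  move=> az; have := ND k 0 az adjointable0.
  by rewrite scale0r addr0 ComplexField.Normc.normc0 mul0r addr0.
move=> ax; apply/le_anti; rewrite NZ_le//=.
have [->|c0] := eqVneq c 0; first by rewrite ComplexField.Normc.normc0 mul0r N_ge0.
have := NZ_le c^-1 _ (adjointableZ c ax); rewrite scalerA mulVf// scale1r.
by rewrite ComplexField.Normc.normcV ler_pdivlMl// normc_gt0.
Qed.

Lemma N_sharp x : adjointable a x -> N (sharp x) = N x.
Proof.
move=> ax; have xy := is_adjoint_sharp ax; rewrite /N; congr fine.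
by apply/le_anti; rewrite !anorm_adjoint_le//; exact: is_adjoint_sym.
Qed.

Lemma RmapE x k : adjointable a x ->
  Rx x k = ((t%:C)%C * k) *: x + ((s%:C)%C * conjc k) *: sharp x.
Proof. by move=> ax; rewrite /Rx /Rmap sharpP.2// !scalerA. Qed.

Lemma adjointable_Rmap x k : adjointable a x -> adjointable a (Rx x k).
Proof.
move=> ax; rewrite RmapE//; apply: adjointable_linear => //.
exact/adjointableZ/adjointable_sharp.
Qed.

Lemma N_Rmap_le x theta : adjointable a x -> N (Rx x (cexpi theta)) <= (t + s) * N x.
Proof.
move=> ax; rewrite RmapE//.
rewrite (le_trans (ND _ _ ax (adjointable_sharp ax)))//.
rewrite !ComplexField.Normc.normcM normc_conj normc_cexpi !normc_real !mulr1.
by rewrite !ger0_norm// N_sharp// mulrDl.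
Qed.

Lemma vnorm_ubound x theta : (anorm a (Rx x (cexpi theta)) <= vnorm a t s sharp x)%E.
Proof. by apply: ereal_sup_ubound; exists theta. Qed.

Lemma vnorm_le x (m : \bar R) :
  (forall theta, (anorm a (Rx x (cexpi theta)) <= m)%E) -> (vnorm a t s sharp x <= m)%E.
Proof. by move=> le_m; apply/ereal_supP => _ [theta _ <-]; exact: le_m. Qed.

Lemma vnorm_le_anorm x : adjointable a x ->
  (vnorm a t s sharp x <= (t + s)%:E * anorm a x)%E.
Proof.
move=> ax; apply: vnorm_le => theta; rewrite !anormE//; last exact: adjointable_Rmap.
by rewrite -EFinM lee_fin N_Rmap_le.
Qed.

Lemma vnorm_ge0 x : (0 <= vnorm a t s sharp x)%E.
Proof. exact: le_trans (anorm_ge0 _ _) (vnorm_ubound x 0). Qed.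

Lemma vnorm_fin_num x : adjointable a x -> vnorm a t s sharp x \is a fin_num.
Proof.
move=> ax; rewrite ge0_fin_numE ?vnorm_ge0// (le_lt_trans (vnorm_le_anorm ax))//.
by rewrite anormE// -EFinM ltry.
Qed.

(* R(x) - i R(i x) = 2 t x and R(x) + i R(i x) = 2 s x^#. *)
Lemma anorm_le_vnorm x : adjointable a x ->
  ((Num.max t s)%:E * anorm a x <= vnorm a t s sharp x)%E.
Proof.
move=> ax; have asx := adjointable_sharp ax.
have vE := fineK (vnorm_fin_num ax).
have W theta : N (Rx x (cexpi theta)) <= fine (vnorm a t s sharp x).
  by rewrite -lee_fin vE -anormE ?vnorm_ubound//; exact: adjointable_Rmap.
(* The angles 0 and pi / 2 give R(x) and R(i x). *)
have := W 0; have := W (pi / 2); rewrite cexpi0 cexpi_pihalf.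
rewrite anormE// -vE -EFinM lee_fin; set V := fine (vnorm _ _ _ _ _) => Wi W1.
have ni : normc ('i%C : R[i]) = 1 by rewrite /= expr0n expr1n add0r sqrtr1.
have nNi : normc (- 'i%C : R[i]) = 1 by rewrite /= oppr0 sqrrN expr0n expr1n add0r sqrtr1.
have half : normc ((2^-1%:C)%C : R[i]) = 2^-1 by rewrite normc_real ger0_norm.
(* Instantiated at k = -i to isolate t x and at k = i to isolate s x^#. *)
have avg k : normc k = 1 ->
    N ((2^-1%:C)%C *: Rx x 1 + ((2^-1%:C)%C * k) *: Rx x 'i%C) <= V.
  move=> k1; have ax1 := adjointable_Rmap 1 ax; have axi := adjointable_Rmap 'i%C ax.
  rewrite (le_trans (ND _ _ ax1 axi))//.
  rewrite ComplexField.Normc.normcM k1 half mulr1 -mulrDr ler_pdivrMl//.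
  by rewrite mulr_natl mulr2n lerD.
have tx : t * N x <= V.
  have := avg _ nNi; rewrite !RmapE// !scalerDr !scalerA addrACA -!scalerDl.
  rewrite [X in X *: x](_ : _ = (t%:C)%C); last first.
    by apply/eqP; rewrite eq_complex /=; apply/andP; split; apply/eqP; field.
  rewrite [X in X *: sharp x](_ : _ = 0); last first.
    by apply/eqP; rewrite eq_complex /=; apply/andP; split; apply/eqP; field.
  by rewrite scale0r addr0 NZ// normc_real ger0_norm.
have sx : s * N x <= V.
  have := avg _ ni; rewrite !RmapE// !scalerDr !scalerA addrACA -!scalerDl.
  rewrite [X in X *: x](_ : _ = 0); last first.
    by apply/eqP; rewrite eq_complex /=; apply/andP; split; apply/eqP; field.
  rewrite [X in X *: sharp x](_ : _ = (s%:C)%C); last first.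
    by apply/eqP; rewrite eq_complex /=; apply/andP; split; apply/eqP; field.
  by rewrite scale0r add0r NZ// normc_real ger0_norm// N_sharp.
by case: (leP t s).
Qed.

(** In polar form the phase of c only shifts theta, while its modulus, being real, commutes with
    conjugation and factors out. *)
Lemma vnormZ_le c x : adjointable a x ->
  (vnorm a t s sharp (c *: x) <= (normc c)%:E * vnorm a t s sharp x)%E.
Proof.
move=> ax; apply: vnorm_le => theta; have [phi {1}->] := polar_form c.
have -> : Rx ((normc c)%:C%C * cexpi phi *: x) (cexpi theta) =
          (normc c)%:C%C *: Rx x (cexpi (theta + phi)).
  rewrite {1}/Rx scalerA mulrCA -cexpiD -/(Rx x _) !RmapE// scalerDr !scalerA.
  have conj_real k (r : R) : conjc ((r%:C)%C * k) = (r%:C)%C * conjc k.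
    by case: k => u v; apply/eqP; rewrite eq_complex /=; apply/andP; split;
      apply/eqP; ring.
  by rewrite conj_real [(t%:C)%C * _]mulrCA [(s%:C)%C * _]mulrCA.
rewrite (le_trans (anormZ_le pa _ _))// normc_real ger0_norm ?normc_ge0//.
by rewrite lee_wpmul2l ?lee_fin ?normc_ge0// vnorm_ubound.
Qed.

Lemma vnormZ c x : adjointable a x ->
  vnorm a t s sharp (c *: x) = ((normc c)%:E * vnorm a t s sharp x)%E.
Proof.
move=> ax; apply/le_anti; rewrite vnormZ_le//=.
have [->|c0] := eqVneq c 0.
  by rewrite ComplexField.Normc.normc0 mul0e vnorm_ge0.
have acx := adjointableZ c ax.
have := vnormZ_le c^-1 acx; rewrite scalerA mulVf// scale1r.
rewrite -(fineK (vnorm_fin_num ax)) -(fineK (vnorm_fin_num acx)) -!EFinM !lee_fin.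
by rewrite ComplexField.Normc.normcV ler_pdivlMl// normc_gt0.
Qed.

(** [sharp] need not be additive, but [sharp (x + y)] and [sharp x + sharp y] agree after left
    multiplication by [a], which suffices by [eq_anorm]. *)
Lemma vnormD x y : adjointable a x -> adjointable a y ->
  (vnorm a t s sharp (x + y)%R <= vnorm a t s sharp x + vnorm a t s sharp y)%E.
Proof.
move=> ax ay; apply: vnorm_le => theta; set k := cexpi theta.
have axy : adjointable a (x + y) by rewrite -[x]scale1r; exact: adjointable_linear.
have -> : anorm a (Rx (x + y) k) = anorm a (Rx x k + Rx y k).
  apply: eq_anorm => //; rewrite !RmapE// !mulrDr -!scalerAr mulrDr.
  rewrite !is_adjoint_sharp// starD mulrDl !scalerDr addrACA.
  by [].
by rewrite (le_trans (anormD _ _ _))// leeD ?vnorm_ubound.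
Qed.

End VNorm.

Theorem theorem2p6 (R : realType) (A : cstarAlgType R) (a : A) (t s : R)
    (sharp : A -> A) :
  a <> 0 -> positive a ->
  0 <= t -> 0 <= s -> 0 < t + s ->
  adjoint_choice a sharp ->
  seminorm_on (adjointable a) (vnorm a t s sharp) /\
  (forall x : A, adjointable a x ->
     ((Num.max t s)%:E * anorm a x <= vnorm a t s sharp x)%E /\
     (vnorm a t s sharp x <= (t + s)%:E * anorm a x)%E).
Proof.
move=> _ pa t0 s0 _ sharpP; split; last first.
  by move=> x ax; split; [exact: anorm_le_vnorm | exact: vnorm_le_anorm].
split.
- by split=> [|c x y]; [exact: adjointable0 | exact: adjointable_linear].
- by move=> x ax; split; [exact: vnorm_fin_num | exact: vnorm_ge0].
- by move=> c x; exact: vnormZ.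
- by move=> x y; exact: vnormD.
Qed.
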